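(* Let $G$ be a Lie group modelled on a locally convex space $E$ such that the underlying topological space of $E$ is a $k_\omega$-space. Then $G$ is locally $k_\omega$, and the identity component $G_e$ of $G$ is $k_\omega$.
   Context: A $k_\omega$-space is a Hausdorff topological space $X$ for which there is an ascending sequence $K_1\subseteq K_2\subseteq\cdots$ of compact subsets $K_n\subseteq X$ with $\bigcup_{n\in\mathbb{N}}K_n=X$ such that $X$ carries the direct limit topology, i.e., a subset $A\subseteq X$ is closed if and only if $A\cap K_n$ is closed in $K_n$ for each $n\in\mathbb{N}$. A Hausdorff topological space $X$ is called locally $k_\omega$ if each $x\in X$ has an open neighbourhood $U\subseteq X$ which is a $k_\omega$-space in the induced topology. A topological group is called $k_\omega$ (resp. locally $k_\omega$) if its underlying topological space is a $k_\omega$-space (resp. locally $k_\omega$). Locally convex spaces are real or complex Hausdorff locally convex topological vector spaces. Smoothness is understood in the sense of Keller's $C^\infty_c$-theory: for locally convex spaces $E,F$ over $\mathbb{K}\in\{\mathbb{R},\mathbb{C}\}$ and $U\subseteq E$ open, a map $f\colon U\to F$ is $C^\infty$ if it is continuous and, for each $k\in\mathbb{N}$, the iterated directional derivatives $d^{(k)}f(x,y_1,\ldots,y_k)=(D_{y_k}\cdots D_{y_1}f)(x)$ (over $\mathbb{K}$) exist for all $x\in U$, $y_1,\ldots,y_k\in E$ and define continuous maps $d^{(k)}f\colon U\times E^k\to F$. A Lie group modelled on $E$ is a group $G$ endowed with a smooth manifold structure modelled on $E$ (with Hausdorff underlying topology, charts being homeomorphisms onto open subsets of $E$ with smooth transition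 maps) such that the group multiplication and inversion are smooth; in particular, $G$ is a Hausdorff topological group. *)

(* Defs.v *)
From HB Require Import structures.
From mathcomp Require Import all_boot all_order all_algebra.
From mathcomp Require Import all_classical all_reals topology normedtype.
From mathcomp Require Import complex.

Set Implicit Arguments.
Unset Strict Implicit.
Unset Printing Implicit Defensive.

Import Order.TTheory GRing.Theory Num.Theory.
Import numFieldNormedType.Exports.

Local Open Scope classical_set_scope.
Local Open Scope ring_scope.

Definition k_omega (X : topologicalType) : Prop :=
  hausdorff_space X /\
  exists K : nat -> set X,
    [/\ forall n, compact (K n),
        forall n, K n `<=` K n.+1,
        \bigcup_n K n = [set: X] &
        forall A : set X,
          closed A <-> forall n, closed (A `&` K n : set (subspace (K n)))].

(* [set_type U] carries the topology induced by the inclusion into [X]. *)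
Definition locally_k_omega (X : topologicalType) : Prop :=
  hausdorff_space X /\
  forall x : X, exists U : set X, [/\ open U, U x & k_omega (set_type U)].

Variant scalar_kind := RealScalars | ComplexScalars.

Definition scalar_field (R : realType) (s : scalar_kind) : numFieldType :=
  match s with RealScalars => R | ComplexScalars => R[i] end.

Section KellerSmooth.
Context {K : numFieldType} {E F : tvsType K}.

(* The counterparts of the library's [derivable] and ['D_v f], which are
   restricted to normed modules; [xget 0] plays the role of [lim], which needs
   a pointed target. *)
Definition diff_quot (f : E -> F) (x y : E) (h : K) : F :=
  h^-1 *: (f (h *: y + x) - f x).

Definition tvs_derivable (f : E -> F) (x y : E) : Prop :=
  exists l : F, diff_quot f x y @ 0^' --> l.

Definition tvs_derive (f : E -> F) (y : E) : E -> F :=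
  fun x => xget 0 [set l : F | diff_quot f x y @ 0^' --> l].

(* For ys = [:: y_1; ...; y_k] this is D_{y_k} ... D_{y_1} f. *)
Definition iter_derive (f : E -> F) (ys : seq E) : E -> F :=
  foldl tvs_derive f ys.

Definition row_seq (k : nat) (y : 'rV[E]_k) : seq E :=
  [seq y ord0 i | i <- enum 'I_k].

(* Keller's C^oo_c maps on an open set U. A map U -> F is represented by any
   extension to E: since U is open, the derivatives at points of U do not
   depend on the extension. E^k is represented by row vectors, which carry the
   product topology. *)
Definition Cinfty (U : set E) (f : E -> F) : Prop :=
  [/\ {within U, continuous f},
      forall (ys : seq E) (x y : E), U x -> tvs_derivable (iter_derive f ys) x y
    & forall k : nat, {within U `*` [set: 'rV[E]_k],
        continuous (fun p : E * 'rV[E]_k => iter_derive f (row_seq p.2) p.1)}].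

End KellerSmooth.

(* A partial homeomorphism from [chart_dom] onto [chart_img]; the values of the
   two maps outside these sets are irrelevant. *)
Record chart (M E : Type) := Chart {
  chart_dom : set M;
  chart_fun : M -> E;
  chart_inv : E -> M }.

Definition chart_img (M E : Type) (c : chart M E) : set E :=
  chart_fun c @` chart_dom c.

Definition is_chart (M E : topologicalType) (c : chart M E) : Prop :=
  [/\ open (chart_dom c),
      open (chart_img c),
      (forall x, chart_dom c x -> chart_inv c (chart_fun c x) = x),
      {within chart_dom c, continuous (chart_fun c)} &
      {within chart_img c, continuous (chart_inv c)}].

Definition prod_chart (M N E F : Type) (c : chart M E) (d : chart N F) :
    chart (M * N) (E * F) :=
  Chart (chart_dom c `*` chart_dom d)
        (fun p => (chart_fun c p.1, chart_fun d p.2))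
        (fun q => (chart_inv c q.1, chart_inv d q.2)).

Definition prod_atlas (M N E F : Type)
    (A : set (chart M E)) (B : set (chart N F)) :
    set (chart (M * N) (E * F)) :=
  [set e | exists c d, [/\ A c, B d & e = prod_chart c d]].

Section SmoothManifold.
Context {K : numFieldType}.

(* The manifold structure is given by an atlas, not necessarily maximal;
   compatible atlases define the same structure. *)
Definition smooth_atlas (M : topologicalType) (E : tvsType K)
    (A : set (chart M E)) : Prop :=
  [/\ forall c, A c -> is_chart c,
      \bigcup_(c in A) chart_dom c = [set: M] &
      forall c d, A c -> A d ->
        Cinfty (chart_fun c @` (chart_dom c `&` chart_dom d))
               (chart_fun d \o chart_inv c)].

Definition smooth_map (M N : topologicalType) (E F : tvsType K)
    (A : set (chart M E)) (B : set (chart N F)) (f : M -> N) : Prop :=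
  continuous f /\
  forall c d, A c -> B d ->
    Cinfty (chart_fun c @` (chart_dom c `&` f @^-1` chart_dom d))
           (chart_fun d \o f \o chart_inv c).

End SmoothManifold.

(* A group and a topology on the same carrier, with no compatibility. *)
#[short(type="preTopologicalGroupType")]
HB.structure Definition PreTopologicalGroup := {G of Topological G & Group G}.

Definition lie_group (K : numFieldType) (E : tvsType K)
    (G : preTopologicalGroupType) (A : set (chart G E)) : Prop :=
  [/\ hausdorff_space G,
      smooth_atlas A,
      smooth_map (prod_atlas A A) A (fun p : G * G => (p.1 * p.2)%g) &
      smooth_map A A (fun x : G => (x^-1)%g)].

(* Main.v *)
Require Import Defs.
From mathcomp Require Import all_boot all_order all_algebra.
From mathcomp Require Import all_classical all_reals topology normedtype.

Import Order.TTheory GRing.Theory Num.Theory numFieldNormedType.Exports.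

(** Of the Lie group structure only three facts matter: G is a Hausdorff
topological group, and every point of G has an open neighbourhood that is
homeomorphic to an open subset of the model space E.

Let K_n be a sequence of compact sets determining the topology of E. A
topological vector space is uniform, hence completely regular, so a point p of
an open set O is separated from the complement of O by a continuous function f
with f(p) = 0 and f = 1 outside O. The open set V = {f < 1} is the union of the
closed sets C_n = {f <= 1 - 1/(n+1)}, each contained in the interior of the
next one, and this makes V a k_omega-space for the intersections of K_n with
C_n ([k_omega_on_exhaustion], [k_omega_on_uniform_nbhs]). Transporting such
sets along the charts ([chart_k_omega_nbhs]) shows that G is locally k_omega.

For the identity component, let U be an open k_omega-neighbourhood of 1, with
compact sets K_n. Put Q_0 = {1}, let Q_(n+1) be the union of Q_n and of the
product Q_n K_n, and let H be the union of the Q_n. Then H contains 1 and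
H U is contained in H, which forces H to be both open and closed, so that the
identity component C lies in H. Each Q_n is compact, as a union of products of
compact sets. The Q_n make H a k_omega-space
([k_omega_on_word_set_bigcup]): for x in H, each translate x K_n is contained
in some Q_N; so if A meets every Q_N in a closed set, the left translate of A
by the inverse of x meets every K_n in a closed set, and therefore its trace
on U is closed in U, meaning that A is closed near x. Finally C is closed in H,
and closed subsets inherit the k_omega-property. *)

Local Open Scope classical_set_scope.

(** * Subsets that are k_omega-spaces *)

(** The subset U of X is a k_omega-space for the ascending sequence K of compact
sets, expressed inside X. The last clause says that every A whose traces on the
K n are all closed has a trace on U that is closed in U. The traces are required
to be closed in X, which for a Hausdorff X is the same as being closed in the
compact set K n. *)
Definition k_omega_on (X : topologicalType) (U : set X) (K : nat -> set X) :
    Prop :=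
  [/\ forall n, compact (K n),
      forall n, K n `<=` K n.+1,
      \bigcup_n K n = U &
      forall (A : set X) (x : X), (forall n, closed (A `&` K n)) ->
        U x -> ~ A x -> \forall y \near x, U y -> ~ A y].

Lemma nondecreasing_setP {T : Type} (K : nat -> set T) :
  (forall n, K n `<=` K n.+1) -> forall m n, (m <= n)%N -> K m `<=` K n.
Proof.
move=> Kincr m n /subnK <-; elim: (n - m)%N => [//|d IHd].
exact: subset_trans IHd (Kincr _).
Qed.

Lemma set_type_nbhsP {X : topologicalType} {U : set X} (x : set_type U)
    (W : set (set_type U)) :
  nbhs x W <-> exists O, [/\ open O, O (val x) & val @^-1` O `<=` W].
Proof.
split; first by case=> _ /= [[O oO <-] Ox OW]; exists O.
by move=> [O [oO Ox OW]]; exists (val @^-1` O); split => //; exists O.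
Qed.

Lemma set_type_val_continuous {X : topologicalType} {U : set X} :
  continuous (val : set_type U -> X).
Proof. exact: (@initial_continuous _ _ (@set_val X U)). Qed.

Lemma set_type_hausdorff {X : topologicalType} (U : set X) :
  hausdorff_space X -> hausdorff_space (set_type U).
Proof.
move=> hX p q clpq; apply: val_inj; apply: hX => A B /= pA qB.
have [z [Az Bz]] :=
  clpq _ _ (set_type_val_continuous p A pA) (set_type_val_continuous q B qB).
by exists (val z).
Qed.

Lemma set_type_compact {X : topologicalType} {U K : set X} :
  compact K -> K `<=` U -> compact (val @^-1` K : set (set_type U)).
Proof.
move=> cK KU F FF FK.
have [p [Kp clp]] := cK (val @ F) _ FK.
have Up : p \in U by apply/mem_set/KU.
exists (exist _ p Up); split => // A B FA /set_type_nbhsP[O [oO Op OB]].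
have [] := clp (val @` A) O.
- by apply: (@filterS _ F _ A) => // a Aa; exists a.
- exact: open_nbhs_nbhs.
by move=> _ [[a Aa <-] Oa]; exists a; split => //; exact: OB.
Qed.

(** The two forms of the k_omega-property of a subset agree: the intrinsic one
follows from the one expressed in the ambient space. *)
Lemma k_omega_on_set_type {X : topologicalType} {U : set X}
    {K : nat -> set X} :
  hausdorff_space X -> k_omega_on X U K -> k_omega (set_type U).
Proof.
move=> hX [cK Kincr KU KA].
have KsU n : K n `<=` U by move=> x Kx; rewrite -KU; exists n.
have hU := set_type_hausdorff U hX.
have cK' n := set_type_compact (cK n) (KsU n).
split => //; exists (fun n => val @^-1` K n); split => //.
- by move=> n x; exact: Kincr.
- apply/seteqP; split => // x _.
  by have := set_valP x; rewrite -{1}KU => -[n _ Kx]; exists n.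
move=> A; split=> [clA n|clA].
  by apply: closed_subspaceW; apply: closedI => //; exact: compact_closed.
rewrite -openC openE => x nAx.
(* The trace of A on K n is compact, and so is its image in X. *)
have clA' n : closed (val @` A `&` K n).
  have -> : val @` A `&` K n = val @` (A `&` val @^-1` K n).
    apply/seteqP; split; first by move=> _ [[a Aa <-] Ka]; exists a.
    by move=> _ [a [Aa Ka] <-]; split => //; exists a.
  apply: compact_closed => //; apply: continuous_compact.
    exact/continuous_subspaceT/set_type_val_continuous.
  have clK : closed (val @^-1` K n : set (set_type U)) by exact: compact_closed.
  apply: subclosed_compact (cK' n) _; last exact: subIsetr.
  by have := clA n; rewrite -(closed_setIS _ clK) -setIA setIid.
have near_nA : \forall y \near val x, U y -> ~ (val @` A) y.
  apply: KA clA' (set_valP x) _ => -[a Aa /val_inj ax].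
  by apply: nAx; rewrite -ax.
apply: (@filterS _ (nbhs x) _ _ _ _ (set_type_val_continuous x _ near_nA)).
move=> y /= nAy Ay.
by apply: (nAy (set_valP y)); exists y.
Qed.

Lemma k_omega_on_setT {X : topologicalType} :
  k_omega X -> exists K, k_omega_on X [set: X] K.
Proof.
move=> [hX [K [cK Kincr KT KA]]]; exists K; split => // A x clA _ nAx.
have clAX : closed A.
  by apply/KA => n; apply: closed_subspaceW; exact: clA.
by have := open_nbhs_nbhs (conj (closed_openC clAX) nAx); apply: filterS.
Qed.

Lemma k_omega_on_closedI {X : topologicalType} {U F : set X}
    {K : nat -> set X} :
  closed F -> k_omega_on X U K -> k_omega_on X (U `&` F) (fun n => K n `&` F).
Proof.
move=> clF [cK Kincr KU KA]; split.
- by move=> n; exact: compact_closedI.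
- by move=> n; apply: setSI; exact: Kincr.
- by rewrite -setI_bigcupl KU.
move=> A x clA [Ux Fx] nAx.
have : \forall y \near x, U y -> ~ (A `&` F) y.
  apply: KA => // [n|[]//]; rewrite -setIA (setIC F); exact: clA.
by apply: filterS => y nAF [Uy Fy] Ay; exact: nAF.
Qed.

(** * Open subsets of k_omega-spaces *)

(** An open set exhausted by closed sets, each in the interior of the next one,
inherits the k_omega-property. *)
Lemma k_omega_on_exhaustion {X : topologicalType} {U : set X}
    {K C : nat -> set X} :
  hausdorff_space X -> k_omega_on X U K ->
  (forall n, closed (C n)) -> (forall n, C n `<=` interior (C n.+1)) ->
  \bigcup_n C n `<=` U ->
  k_omega_on X (\bigcup_n C n) (fun n => K n `&` C n).
Proof.
move=> hX [cK Kincr KU KA] clC Cint CU.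
have Cincr n : C n `<=` C n.+1 by move=> x /Cint /nbhs_singleton.
have leK := nondecreasing_setP _ Kincr.
have leC := nondecreasing_setP _ Cincr.
split.
- by move=> n; exact: compact_closedI.
- by move=> n x [Kx Cx]; split; [exact: Kincr|exact: Cincr].
- apply/seteqP; split; first by move=> x [n _ [_ Cx]]; exists n.
  move=> x [n _ Cx].
  have : U x by apply: CU; exists n.
  rewrite -KU => -[m _ Kx]; exists (maxn m n) => //; split.
    by apply: leK Kx; exact: leq_maxl.
  by apply: leC Cx; exact: leq_maxr.
move=> A x clA [m _ Cx] nAx.
(* It suffices to treat the trace of A on C m.+1, a neighbourhood of x: its
   intersection with K n is part of the trace of A on K N `&` C N as soon as
   N is at least n and m.+1. *)
have clAC n : closed (A `&` C m.+1 `&` K n).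
  have -> : A `&` C m.+1 `&` K n =
      A `&` (K (maxn n m.+1) `&` C (maxn n m.+1)) `&` (C m.+1 `&` K n).
    apply/seteqP; split => y; last by move=> [[Ay _] [Cy Ky]].
    move=> [[Ay Cy] Ky]; split => //; split => //; split.
      by apply: leK Ky; exact: leq_maxl.
    by apply: leC Cy; exact: leq_maxr.
  apply: closedI; first exact: clA.
  by apply: closedI => //; exact: compact_closed.
have Ux : U x by apply: CU; exists m.
have nACx : ~ (A `&` C m.+1) x by move=> [].
apply: filterS2 (KA _ _ clAC Ux nACx) (Cint _ _ Cx) => y nACy Cy [k _ Cky] Ay.
apply: nACy; last by split.
by apply: CU; exists k.
Qed.

(** Transport of the k_omega-property along the homeomorphism g from V onto its
image, with inverse f. *)
Lemma k_omega_on_image {X Y : topologicalType} {V : set Y} {K : nat -> set Y}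
    {f : X -> Y} {g : Y -> X} :
  hausdorff_space Y -> k_omega_on Y V K ->
  (forall v, V v -> f (g v) = v) ->
  (forall v, V v -> {for v, continuous g}) ->
  (forall v, V v -> {for g v, continuous f}) ->
  k_omega_on X (g @` V) (fun n => g @` K n).
Proof.
move=> hY [cK Kincr KV KA] gK cg cf.
have KsV n : K n `<=` V by move=> x Kx; rewrite -KV; exists n.
split.
- move=> n; apply: continuous_compact (cK n).
  by apply: continuous_in_subspaceT => y /set_mem /KsV; exact: cg.
- by move=> n; apply: image_subset; exact: Kincr.
- by rewrite -image_bigcup KV.
move=> A _ clA [v Vv <-] nAv.
have clgA n : closed ((g @^-1` A) `&` K n).
  rewrite -openC openE => y nAKy.
  have clK : closed (K n) by exact: compact_closed.
  have [Ky|nKy] := pselect (K n y); last first.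
    have := open_nbhs_nbhs (conj (closed_openC clK) nKy).
    by apply: filterS => z nKz [].
  have nAKgy : (~` (A `&` g @` K n)) (g y).
    by move=> [Agy _]; apply: nAKy.
  have nearAK := open_nbhs_nbhs (conj (closed_openC (clA n)) nAKgy).
  apply: (@filterS _ (nbhs y) _ _ _ _ (cg y (KsV _ _ Ky) _ nearAK)).
  by move=> z /= nAKz [Agz Kz]; apply: nAKz; split => //; exists z.
have nearV : \forall w \near f (g v), V w -> ~ A (g w).
  by rewrite gK //; exact: KA clgA Vv nAv.
apply: (@filterS _ (nbhs (g v)) _ _ _ _ (cf v Vv _ nearV)) => z.
by move=> /= nA [w Vw gw]; rewrite -gw gK // in nA *; exact: nA.
Qed.

(** In a uniform space, an open set contained in a k_omega-subset contains an open
k_omega-neighbourhood of each of its points. *)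
Lemma k_omega_on_uniform_nbhs (R : realType) {E : uniformType} {U : set E}
    {K : nat -> set E} {p : E} {O : set E} :
  hausdorff_space E -> k_omega_on E U K -> O `<=` U -> open O -> O p ->
  exists V L, [/\ open V, V p, V `<=` O & k_omega_on E V L].
Proof.
move=> hE kU OU oO Op.
have clO : closed (~` O) by exact: open_closedC.
have [|f [cf _ fp f1]] :=
  (uniform_separatorP (R := R) _ _).1
    (@point_uniform_separator R E p _ clO _).
  by move=> /(_ Op).
have {}fp : f p = 0%R by apply: fp; exists p.
pose C n := f @^-1` [set r | r <= 1 - n.+1%:R^-1]%R.
have f_lt1P x : (f x < 1)%R -> exists n, C n x.
  move=> /ltr_add_invr[n fx1]; exists n.
  by rewrite /C /= lerBrDr ltW.
have CO : \bigcup_n C n `<=` O.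
  move=> x [n _]; rewrite /C /= => fx; apply: contrapT => nOx.
  have {}f1 : f x = 1%R by apply: f1; exists x.
  by move: fx; rewrite f1 lerBrDr gerDl leNgt invr_gt0 ltr0Sn.
exists (\bigcup_n C n), (fun n => K n `&` C n); split => //.
- have -> : \bigcup_n C n = f @^-1` [set r | r < 1]%R.
    apply/seteqP; split => x; last by move=> /f_lt1P[n Cx]; exists n.
    move=> [n _]; rewrite /C /= => /le_lt_trans; apply.
    by rewrite ltrBlDr ltrDl invr_gt0 ltr0Sn.
  by apply: open_comp => [? _|]; [exact: cf|exact: open_lt].
- by exists 0%N => //; rewrite /C /= fp invr1 subrr.
apply: k_omega_on_exhaustion (kU) _ _ _ => //.
- by move=> n; apply: preimage_closed => [? _|]; [exact: cf|exact: closed_le].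
- move=> n x; rewrite /C /= => fx.
  apply: (@filterS _ (nbhs x) _ (f @^-1` [set r | r < 1 - n.+2%:R^-1]%R)).
    by move=> y; exact: ltW.
  apply: open_nbhs_nbhs; split.
    by apply: open_comp => [? _|]; [exact: cf|exact: open_lt].
  apply: le_lt_trans fx _.
  by rewrite ltrD2l ltrN2 ltf_pV2 ?posrE ?ltr0Sn // ltr_nat.
- exact: subset_trans CO OU.
Qed.

(** * The identity component of a topological group *)

Lemma connected_component_sub_clopen {T : topologicalType} {H : set T}
    {x : T} :
  open H -> closed H -> H x -> connected_component [set: T] x `<=` H.
Proof.
move=> oH cH Hx y [B [Bx _ cB] By].
have BH : B `&` H = B by apply: cB; [exists x | exists H | exists H].
by move: By; rewrite -BH => -[].
Qed.

Section TopologicalGroup.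
Context {G : preTopologicalGroupType}.
Hypothesis mul_continuous : continuous (fun p : G * G => (p.1 * p.2)%g).
Hypothesis inv_continuous : continuous (fun x : G => (x^-1)%g).

Lemma continuous_lmulg (a : G) : continuous (fun x : G => (a * x)%g).
Proof.
move=> x; apply: (@continuous_comp _ _ _ (fun y : G => (a, y))
  (fun p : G * G => (p.1 * p.2)%g)); last exact: mul_continuous.
by apply: cvg_pair; [exact: cvg_cst|exact: cvg_id].
Qed.

(** The sets Q_n of products x_1 ... x_k of at most n factors with x_i in some
K m, where the indices m increase strictly with i and are less than n. For an
ascending sequence K their union consists of all products of elements of the
union of the K m. *)
Fixpoint word_set (K : nat -> set G) (n : nat) : set G :=
  if n is m.+1 then
    word_set K m `|`
    (fun p : G * G => (p.1 * p.2)%g) @` (word_set K m `*` K m)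
  else [set 1%g].

Lemma compact_word_set {K : nat -> set G} :
  (forall n, compact (K n)) -> forall n, compact (word_set K n).
Proof.
move=> cK; elim=> [|n IHn] /=; first exact: compact_set1.
apply: compactU => //; apply: continuous_compact.
  exact: continuous_subspaceT.
exact: compact_setX.
Qed.

Lemma word_set_incr (K : nat -> set G) n : word_set K n `<=` word_set K n.+1.
Proof. by move=> x; left. Qed.

Lemma word_set_mul {K : nat -> set G} {m n : nat} {x y : G} :
  (forall n, K n `<=` K n.+1) ->
  word_set K m x -> K n y -> word_set K (maxn m n).+1 (x * y)%g.
Proof.
move=> Kincr Wx Ky; right; exists (x, y) => //; split => /=.
  exact: nondecreasing_setP (word_set_incr K) _ _ (leq_maxl _ _) _ Wx.
exact: nondecreasing_setP Kincr _ _ (leq_maxr _ _) _ Ky.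
Qed.

Context {U : set G} {K : nat -> set G}.
Hypothesis oU : open U.
Hypothesis U1 : U 1%g.
Hypothesis kU : k_omega_on G U K.

Let H := \bigcup_n word_set K n.

Lemma word_set_bigcup_mul {x u : G} : H x -> U u -> H (x * u)%g.
Proof.
have [_ Kincr KU _] := kU; move=> [m _ Wx]; rewrite -KU => -[n _ Ku].
by exists (maxn m n).+1 => //; exact: word_set_mul.
Qed.

Lemma nbhs_lcoset (x : G) : nbhs x [set y | U (x^-1 * y)%g].
Proof.
apply: (@continuous_lmulg (x^-1)%g x U) => /=.
by rewrite mulVg; exact: open_nbhs_nbhs.
Qed.

(** With x, the set H contains the neighbourhood x U of x. *)
Lemma open_word_set_bigcup : open H.
Proof.
rewrite openE => x Hx; apply: (@filterS _ (nbhs x) _ _ _ _ (nbhs_lcoset x)).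
by move=> y /(word_set_bigcup_mul Hx); rewrite mulVKg.
Qed.

(** If x lies outside H, then so do all y with x in y U, and they form a
neighbourhood of x. *)
Lemma closed_word_set_bigcup : closed H.
Proof.
rewrite -openC openE => x nHx.
have nbhs_inv : nbhs x [set y | U (y^-1 * x)%g].
  apply: (@continuous_comp _ _ _ (fun y : G => ((y^-1)%g, x))
    (fun p : G * G => (p.1 * p.2)%g) x _ _ U) => /=.
  - by apply: cvg_pair; [exact: inv_continuous|exact: cvg_cst].
  - exact: mul_continuous.
  - by rewrite mulVg; exact: open_nbhs_nbhs.
apply: (@filterS _ (nbhs x) _ _ _ _ nbhs_inv) => y Uyx Hy; apply: nHx.
by have := word_set_bigcup_mul Hy Uyx; rewrite mulVKg.
Qed.

Lemma k_omega_on_word_set_bigcup :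
  hausdorff_space G -> k_omega_on G H (word_set K).
Proof.
move=> hG; have [cK Kincr KU KA] := kU; split => //.
- exact: compact_word_set.
- exact: word_set_incr.
move=> A x clA [m _ Wx] nAx.
(* The inclusion of x K_n in Q_N turns the hypothesis on A into one on the
   translate of A by the inverse of x. *)
have clxA n : closed ([set y | A (x * y)%g] `&` K n).
  pose N := (maxn m n).+1.
  have -> : [set y | A (x * y)%g] `&` K n =
      (fun y => (x * y)%g) @^-1` (A `&` word_set K N) `&` K n.
    apply/seteqP; split => y; last by move=> [[Axy _] Ky].
    by move=> [Axy Ky]; split => //; split => //; exact: word_set_mul.
  apply: closedI; last exact: compact_closed.
  by apply: preimage_closed => [? _|]; [exact: continuous_lmulg|exact: clA].
have nA1 : ~ A (x * 1)%g by rewrite mulg1.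
have := KA _ 1%g clxA U1 nA1.
rewrite -(mulVg x) => near1.
have nearx := @continuous_lmulg (x^-1)%g x _ near1.
apply: (@filterS2 _ (nbhs x) _ _ _ _ _ nearx (nbhs_lcoset x)).
by move=> y /= nAy Uxy _; have := nAy Uxy; rewrite mulVKg.
Qed.

Lemma k_omega_identity_component :
  hausdorff_space G ->
  k_omega (set_type (connected_component [set: G] (1%g : G))).
Proof.
move=> hG; set C := connected_component _ _.
have H1 : H 1%g by exists 0%N.
have CH : C `<=` H :=
  connected_component_sub_clopen open_word_set_bigcup closed_word_set_bigcup H1.
have clC : closed C by apply: component_closed.
have := k_omega_on_closedI clC (k_omega_on_word_set_bigcup hG).
rewrite (setIidr CH); exact: k_omega_on_set_type.
Qed.

End TopologicalGroup.

(** * Charts with values in a k_omega-space *)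

Lemma chart_k_omega_nbhs (R : realType) {M : topologicalType} {E : uniformType}
    {c : chart M E} {x : M} :
  hausdorff_space E -> k_omega E -> is_chart c -> chart_dom c x ->
  exists U K, [/\ open U, U x & k_omega_on M U K].
Proof.
move=> hE /k_omega_on_setT[K0 kE] [oD oI cK cf cg] Dx.
have ImgI y : chart_dom c y -> chart_img c (chart_fun c y) by exists y.
have [V [L [oV Vx VI kV]]] :=
  k_omega_on_uniform_nbhs R hE kE (@subsetT _ (chart_img c)) oI (ImgI _ Dx).
have imV : chart_inv c @` V = chart_dom c `&` chart_fun c @^-1` V.
  apply/seteqP; split.
    move=> _ [v Vv <-]; have [y Dy vE] := VI _ Vv.
    have Vy : V (chart_fun c y) by rewrite vE.
    by rewrite -vE cK.
  by move=> y [Dy Vy]; exists (chart_fun c y) => //; exact: cK.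
exists (chart_inv c @` V), (fun n => chart_inv c @` L n); split.
- rewrite imV; apply: (continuous_inP _ oD).1 _ _ oV.
  by rewrite -continuous_open_subspace.
- by rewrite imV; split.
apply: (k_omega_on_image (f := chart_fun c)) => // v Vv.
- by have [y Dy <-] := VI _ Vv; rewrite cK.
- move: cg; rewrite continuous_open_subspace // => /(_ v); apply.
  exact/mem_set/VI.
- move: cf; rewrite continuous_open_subspace // => /(_ (chart_inv c v)); apply.
  by have [y Dy <-] := VI _ Vv; rewrite cK //; exact/mem_set.
Qed.

(* [tvsType] does not include the Hausdorff axiom. *)
Theorem proposition1p2 (R : realType) (s : scalar_kind)
    (E : tvsType (scalar_field R s)) (hausE : hausdorff_space E)
    (komegaE : k_omega E)
    (G : preTopologicalGroupType) (A : set (chart G E)) (lieG : lie_group A) :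
  locally_k_omega G /\
  k_omega (set_type (connected_component [set: G] (1%g : G))).
Proof.
have [hG [chA coverA _] [mulC _] [invC _]] := lieG.
have nbhsG x : exists U K, [/\ open U, U x & k_omega_on G U K].
  have : [set: G] x by [].
  rewrite -coverA => -[c Ac Dx].
  exact: (chart_k_omega_nbhs R hausE komegaE (chA _ Ac) Dx).
split.
  split => // x; have [U [K [oU Ux kU]]] := nbhsG x.
  by exists U; split => //; exact: k_omega_on_set_type kU.
have [U [K [oU U1 kU]]] := nbhsG 1%g.
exact: (k_omega_identity_component mulC invC oU U1 kU hG).
Qed.
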